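(* For every $n\ge 1$, $|\mathfrak{S}_n(132,\mathrm{D}_3)|=C_{n-1}+n-1$.
   Context: $C_n=\frac{1}{n+1}\binom{2n}{n}$ is the $n$-th Catalan number. $\mathfrak{S}_n$ is the set of permutations $\sigma=\sigma_1\sigma_2\cdots\sigma_n$ of $[n]=\{1,\dots,n\}$ in one-line notation. A mesh pattern is a pair $p=(\pi,R)$ with $\pi\in\mathfrak{S}_m$ and $R\subseteq\{0,\dots,m\}\times\{0,\dots,m\}$ (the set of shaded unit cells, each given by its bottom-left corner, in the grid with dots at $(i,\pi_i)$). An occurrence of $p$ in $\sigma\in\mathfrak{S}_n$ is a choice of indices $i_1<\cdots<i_m$ such that $\sigma_{i_1}\cdots\sigma_{i_m}$ is order-isomorphic to $\pi$ and, for every $(a,b)\in R$, there is no index $r$ with $i_a<r<i_{a+1}$ and $v_b<\sigma_r<v_{b+1}$; here $v_1<\cdots<v_m$ is the increasing rearrangement of $\sigma_{i_1},\dots,\sigma_{i_m}$, $i_0=v_0=0$ and $i_{m+1}=v_{m+1}=n+1$. A classical pattern $\pi$ is the mesh pattern $(\pi,\varnothing)$. $\mathfrak{S}_n(p,q)$ is the set of permutations in $\mathfrak{S}_n$ with no occurrence of $p$ and no occurrence of $q$. Here $132$ is the classical pattern and $\mathrm{D}_3=(321,\{(0,0),(3,3)\})$. *)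

(* Defs.v *)
From mathcomp Require Import all_boot all_fingroup.

Set Implicit Arguments.
Unset Strict Implicit.
Unset Printing Implicit Defensive.

Definition catalan (n : nat) : nat := 'C(2 * n, n) %/ n.+1.

(* Permutations are 0-based: the one-line word of s : 'S_n is
   (s 0).+1 (s 1).+1 ... (s (n-1)).+1. *)
Definition one_line n (s : 'S_n) : seq nat := [seq (s k).+1 | k <- enum 'I_n].

(* The cell with bottom-left corner (a, b) is the pair (a, b), 0 <= a, b <= m. *)
Record mesh_pattern (m : nat) := MeshPattern {
  mesh_perm : 'S_m;
  mesh_shade : {set 'I_m.+1 * 'I_m.+1}
}.

Definition classical_pattern m (pi : 'S_m) : mesh_pattern m :=
  MeshPattern pi set0.

Section Occurrence.
Variables (m n : nat) (p : mesh_pattern m) (s : 'S_n).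

(* In the two sequences below positions and values are shifted to 1..n, so
   that the border values are 0 and n+1: they are i_0, i_1, ..., i_m, i_(m+1)
   and v_0, v_1, ..., v_m, v_(m+1). *)
Definition grid_pos (f : {ffun 'I_m -> 'I_n}) : seq nat :=
  0 :: rcons [seq (f k).+1 | k <- enum 'I_m] n.+1.

Definition grid_val (f : {ffun 'I_m -> 'I_n}) : seq nat :=
  0 :: rcons (sort leq [seq (s (f k)).+1 | k <- enum 'I_m]) n.+1.

Definition in_cell (f : {ffun 'I_m -> 'I_n}) (c : 'I_m.+1 * 'I_m.+1)
    (r : 'I_n) : bool :=
  (nth 0 (grid_pos f) c.1 < r.+1 < nth 0 (grid_pos f) c.1.+1) &&
  (nth 0 (grid_val f) c.2 < (s r).+1 < nth 0 (grid_val f) c.2.+1).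

Definition mesh_occurrence (f : {ffun 'I_m -> 'I_n}) : bool :=
  [&& [forall k : 'I_m, forall l : 'I_m, (k < l) ==> (f k < f l)],
      [forall k : 'I_m, forall l : 'I_m,
         (s (f k) < s (f l)) == (mesh_perm p k < mesh_perm p l)]
    & [forall c in mesh_shade p, forall r : 'I_n, ~~ in_cell f c r]].

Definition avoids : bool := ~~ [exists f, mesh_occurrence f].

End Occurrence.

Definition avoiders2 n m1 m2 (p : mesh_pattern m1) (q : mesh_pattern m2)
    : {set 'S_n} :=
  [set s : 'S_n | avoids p s & avoids q s].

Definition perm132 : 'S_3 := tperm (inord 1) (inord 2).
Definition perm321 : 'S_3 := perm (@rev_ord_inj 3).

Lemma one_line_perm132 : one_line perm132 = [:: 1; 3; 2].
Proof.
rewrite /one_line /perm132 -[RHS]/(map (fun j => nth 0 [:: 1; 3; 2] j) (iota 0 3)).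
rewrite -val_enum_ord -map_comp; apply: eq_map => -[[|[|[|//]]] lt_k] /=.
- by rewrite tpermD // -val_eqE /= inordK.
- by rewrite (_ : Ordinal _ = inord 1) ?tpermL ?inordK //; apply/val_inj; rewrite /= inordK.
- by rewrite (_ : Ordinal _ = inord 2) ?tpermR ?inordK //; apply/val_inj; rewrite /= inordK.
Qed.

Lemma one_line_perm321 : one_line perm321 = [:: 3; 2; 1].
Proof.
rewrite /one_line -[RHS]/(map (fun j => nth 0 [:: 3; 2; 1] j) (iota 0 3)).
rewrite -val_enum_ord -map_comp; apply: eq_map => -[[|[|[|//]]] lt_k] /=;
  by rewrite permE.
Qed.

Definition mesh132 : mesh_pattern 3 := classical_pattern perm132.

Definition D3 : mesh_pattern 3 :=
  MeshPattern perm321 [set (ord0, ord0); (ord_max, ord_max)].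

(* Main.v *)
Require Import Defs.
From mathcomp Require Import all_boot all_fingroup zify.

(** Let [s] avoid 132.  The shaded cell (0,0) of [D3] then imposes nothing on an
    occurrence [s i > s j > s k] of 321: a point of that cell would form a 132
    with [s i] and [s j].  So [s] avoids [D3] iff every occurrence of 321 is
    followed by a value exceeding its first entry ([avoids_D3P]).

    Write [s = L m R] with [m] the maximum.  As [s] avoids 132, every value of
    [L] exceeds every value of [R].

    - If [R] is empty, the final [m] follows and exceeds every occurrence of 321
      ([avoids_D3_fix_max]), so [L] is an arbitrary 132-avoiding permutation
      of one letter fewer: this gives the Catalan number.
    - If [R] is nonempty, an inversion in [R] together with [m], or an inversion
      in [L] together with a letter of [R], would be a 321 with nothing large
      after it.  Hence [L] and [R] are increasing, [s] is a nontrivial cyclic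
      shift of the identity, and it is determined by the position of [m]
      ([avoids_132_D3_shift]); every such shift qualifies since it has no 321.
      There are [n - 1] of them.

    The count of 132-avoiders ([card_avoids_132]) comes from deleting the first
    letter.  Prepending the value [j] to a 132-avoider [s] creates no 132 iff the
    values [>= j] of [s] appear in increasing order, which for a 132-avoider
    means [s ord0 <= j].  So the numbers [num132 n j] of 132-avoiders of size
    [n.+1] whose first letter is at most [j] satisfy the ballot recurrence.  Its
    solution, [num132 n j.+1 = 'C(n + j + 2, j.+1) - 'C(n + j + 2, j)] for
    [j <= n], is a Catalan number at [j = n], where the bound on the first letter
    is vacuous. *)

Set Implicit Arguments.
Unset Strict Implicit.
Unset Printing Implicit Defensive.

(** * Pattern avoidance as conditions on triples of positions *)

Definition ffun3 n (i j k : 'I_n) : {ffun 'I_3 -> 'I_n} :=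
  [ffun x : 'I_3 => nth k [:: i; j; k] x].

Lemma enum_ord3 : enum 'I_3 = [:: ord0; inord 1; ord_max].
Proof.
by apply: (inj_map val_inj); rewrite val_enum_ord /= inordK.
Qed.

Lemma forall_ord3 (P : pred 'I_3) :
  [forall x, P x] = [&& P ord0, P (inord 1) & P ord_max].
Proof.
apply/forallP/and3P => [H|[P0 P1 P2] x]; first by split.
have: x \in enum 'I_3 by rewrite mem_enum.
by rewrite enum_ord3 !inE => /or3P[] /eqP ->.
Qed.

Lemma avoids_132P n (s : 'S_n) :
  reflect (forall i j k : 'I_n, i < j -> j < k -> s i < s k -> s k < s j -> False)
          (avoids mesh132 s).
Proof.
have v1 : (inord 1 : 'I_3) = 1 :> nat by rewrite inordK.
have v2 : (inord 2 : 'I_3) = ord_max by apply: val_inj; rewrite /= inordK.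
have E0 : perm132 ord0 = ord0 by rewrite tpermD // -val_eqE /= inordK.
have E1 : perm132 (inord 1) = ord_max by rewrite tpermL v2.
have E2 : perm132 ord_max = inord 1 by rewrite -v2 tpermR.
apply: (iffP idP) => [/existsP H i j k ij jk ik kj|H].
  apply: H; exists (ffun3 i j k); rewrite /mesh_occurrence !forall_ord3 /= !ffunE.
  rewrite E0 E1 E2 /= v1 /=; apply/and3P; split; try lia.
  by apply/forall_inP => c; rewrite inE.
apply/existsP => -[f /and3P[/forallP A /forallP B _]].
apply: (H (f ord0) (f (inord 1)) (f ord_max)).
- by have /forallP/(_ (inord 1))/implyP := A ord0; apply; rewrite v1.
- by have /forallP/(_ ord_max)/implyP := A (inord 1); apply; rewrite v1.
- by have /forallP/(_ ord_max)/eqP := B ord0; rewrite /= E0 E2 v1.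
- by have /forallP/(_ (inord 1))/eqP := B ord_max; rewrite /= E1 E2 v1.
Qed.

Lemma sort_desc3 a b c : c < b -> b < a -> sort leq [:: a; b; c] = [:: c; b; a].
Proof.
move=> cb ba; apply: (sorted_eq leq_trans anti_leq).
- exact: sort_sorted leq_total _.
- by rewrite /= (ltnW cb) (ltnW ba).
by rewrite perm_sort -[[:: c; b; a]]/(rev [:: a; b; c]) perm_sym perm_rev.
Qed.

(** A point in cell (0,0) followed by the first two letters of the 321 is a 132,
    so only the cell (3,3) constrains a 132-avoider. *)
Lemma avoids_D3P n (s : 'S_n) : avoids mesh132 s ->
  reflect (forall i j k : 'I_n, i < j -> j < k -> s j < s i -> s k < s j ->
             exists2 r : 'I_n, k < r & s i < s r)
          (avoids D3 s).
Proof.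
move=> /avoids_132P Av.
have v1 : (inord 1 : 'I_3) = 1 :> nat by rewrite inordK.
have E0 : perm321 ord0 = 2 :> nat by rewrite permE.
have E1 : perm321 (inord 1) = 1 :> nat by rewrite permE /= v1.
have E2 : perm321 ord_max = 0 :> nat by rewrite permE.
apply: (iffP idP) => [/existsP H i j k ij jk ji kj|H].
  case E: [exists (r : 'I_n | k < r), s i < s r].
    by have [r kr ir] := exists_inP E; exists r.
  case: H.
  exists (ffun3 i j k); rewrite /mesh_occurrence !forall_ord3 /= !ffunE.
  rewrite E0 E1 E2 /= v1 /=; apply/and3P; split; try lia.
  apply/forall_inP => c; rewrite !inE => /orP[]/eqP-> ; apply/forallP => r;
    rewrite /in_cell /grid_pos /grid_val enum_ord3 /= !ffunE /= v1 /= sort_desc3 //=.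
  - apply/negP => /andP[A B].
    by apply: (Av r i j); lia.
  - apply/negP => /andP[/andP[A _] /andP[B _]].
    by move/exists_inP: E; apply; exists r.
apply/existsP => -[f /and3P[/forallP A /forallP B /forall_inP C]].
have ij : f ord0 < f (inord 1).
  by have /forallP/(_ (inord 1))/implyP := A ord0; apply; rewrite v1.
have jk : f (inord 1) < f ord_max.
  by have /forallP/(_ ord_max)/implyP := A (inord 1); apply; rewrite v1.
have ji : s (f (inord 1)) < s (f ord0).
  by have /forallP/(_ ord0)/eqP := B (inord 1); rewrite /= E0 E1.
have kj : s (f ord_max) < s (f (inord 1)).
  by have /forallP/(_ (inord 1))/eqP := B ord_max; rewrite /= E1 E2.
have [r kr ir] := H _ _ _ ij jk ji kj.
have /forallP/(_ r)/negP := C (ord_max, ord_max) ltac:(by rewrite !inE eqxx orbT).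
apply; rewrite /in_cell /grid_pos /grid_val enum_ord3 /= sort_desc3 //=.
by rewrite !ltnS kr ir !ltn_ord.
Qed.

(** * Deleting the first or the last letter *)

(** If [s ord0 > j], then [j], [s ord0] and the later letter of the value that
    [j] pushes up to [j.+1] form a 132.  Conversely, in a new 132 starting with
    the prepended [j], the last two letters are an inversion of [s] among values
    [>= j >= s ord0], and [s ord0] precedes them: [s] already had a 132. *)
Lemma avoids_132_lift0 n (j : 'I_n.+2) (s : 'S_n.+1) :
  avoids mesh132 (lift_perm ord0 j s) = avoids mesh132 s && (s ord0 <= j).
Proof.
apply/avoids_132P/andP => [H|[/avoids_132P Av le0j] a b c].
  split.
    apply/avoids_132P => a b c ab bc ac cb.
    by apply: (H (lift ord0 a) (lift ord0 b) (lift ord0 c));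
      rewrite ?lift_perm_lift /= /bump; lia.
  rewrite leqNgt; apply/negP => lt_j0.
  have jn : j < n.+1 by have := ltn_ord (s ord0); lia.
  (* [x] becomes the value [j.+1] in the lifted permutation. *)
  pose x : 'I_n.+1 := Ordinal jn.
  have sx : s (s^-1%g x) = x by rewrite permKV.
  have xn0 : (s^-1)%g x != ord0.
    by apply: contraTneq lt_j0 => e; rewrite -e sx /= ltnn.
  apply: (H ord0 (lift ord0 ord0) (lift ord0 (s^-1%g x))).
  - by [].
  - by rewrite /= /bump /=; move: xn0; rewrite -val_eqE /=; lia.
  - by rewrite lift_perm_id lift_perm_lift sx /= /bump leqnn; lia.
  - by rewrite !lift_perm_lift sx /= /bump; lia.
have [b'|] := unliftP ord0 b; last by move=> -> /=; lia.
have [c'|] := unliftP ord0 c; last by move=> -> /=; lia.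
move=> -> ->.
have [a'|] := unliftP ord0 a => ->; rewrite ?lift_perm_id !lift_perm_lift.
  rewrite /= /bump /= => ab bc ac cb.
  by apply: (Av a' b' c'); lia.
rewrite /= /bump /= => _ bc ac cb.
have cb' : s c' < s b' by lia.
have jc : j <= s c' by lia.
(* [s ord0] serves as the first letter of a 132 unless [b'] is position 0. *)
case: (posnP b') => [b0|b_gt0].
  have eb : b' = ord0 by apply: val_inj.
  by move: cb'; rewrite eb; lia.
have neq : s ord0 != s c'.
  by rewrite (inj_eq perm_inj) -val_eqE /=; lia.
by apply: (Av ord0 b' c') => //; move: neq; rewrite -val_eqE /=; lia.
Qed.

Lemma avoids_132_lift_max n (s : 'S_n) :
  avoids mesh132 (lift_perm ord_max ord_max s) = avoids mesh132 s.
Proof.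
apply/avoids_132P/avoids_132P => [H a b c ab bc ac cb|Av a b c].
  apply: (H (lift ord_max a) (lift ord_max b) (lift ord_max c));
      by rewrite ?lift_perm_lift !lift_max.
have [a'|] := unliftP ord_max a => ->; last by have := ltn_ord b => /=; lia.
have [b'|] := unliftP ord_max b => ->; last by have := ltn_ord c => /=; lia.
have [c'|] := unliftP ord_max c => ->; rewrite ?lift_perm_id !lift_perm_lift !lift_max.
  exact: Av.
by rewrite /=; have := ltn_ord (s b'); lia.
Qed.

Lemma lift_perm_inj n (i j : 'I_n.+1) : injective (@lift_perm n i j).
Proof.
move=> s t est; apply/permP => x; apply: (@lift_inj _ j).
by rewrite -!(lift_perm_lift i) est.
Qed.

(** Together with injectivity: [lift_perm i j] is a bijection onto the
    permutations sending [i] to [j]. *)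
Lemma lift_perm_onto n (i j : 'I_n.+1) (s : 'S_n.+1) : s i = j ->
  exists t, s = lift_perm i j t.
Proof.
move=> sij.
have H x : exists y, s (lift i x) = lift j y.
  case: (unliftP j (s (lift i x))) => [y ->|]; first by exists y.
  by rewrite -sij => /perm_inj/eqP; rewrite eq_sym (negPf (neq_lift _ _)).
have {}H (x : 'I_n) : {y : 'I_n | s (lift i x) = lift j y}.
  by apply: (@sig_eqW _ _ (fun=> s (lift i x)) (lift j)); exact: H.
have inj : injective (fun x => sval (H x)).
  move=> x y; case: (H x) (H y) => [a ea] [b eb] /= ab.
  by apply: (@lift_inj _ i); apply: (@perm_inj _ s); rewrite ea eb ab.
exists (perm inj); apply/permP => x.
have [y|] := unliftP i x => ->; last by rewrite lift_perm_id.
by rewrite lift_perm_lift permE; case: (H y).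
Qed.

Lemma card_lift_perm n (i j : 'I_n.+1) (P : pred 'S_n.+1) :
  #|[set s : 'S_n.+1 | P s & s i == j]| =
  #|[set t : 'S_n | P (lift_perm i j t)]|.
Proof.
rewrite -(card_imset _ (@lift_perm_inj n i j)); apply: eq_card => s.
rewrite inE; apply/andP/imsetP => [[Ps /eqP/lift_perm_onto[t est]]|[t]].
  by exists t; rewrite // inE -est.
by rewrite inE => Pt ->; rewrite lift_perm_id.
Qed.

(** * Counting 132-avoiders *)

(** [F] is the array of ballot numbers, which count lattice paths staying below a
    diagonal; the reflection principle gives the difference of two binomials, put
    here in additive form to stay in [nat].  The inductive step is Pascal's rule;
    on the diagonal, where the cap [F n n.+1 = F n n] takes the place of the
    recurrence, the symmetry of ['C(2n + 3, _)] supplies the second term. *)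
Lemma ballot_binomial (F : nat -> nat -> nat) :
  F 0 0 = 1 ->
  (forall n, F n.+1 0 = F n 0) ->
  (forall n j, j <= n -> F n.+1 j.+1 = F n.+1 j + F n j.+1) ->
  (forall n, F n n.+1 = F n n) ->
  forall n j, j <= n -> F n j.+1 + 'C(n + j + 2, j) = 'C(n + j + 2, j.+1).
Proof.
move=> F00 F0 FS Fcap.
have Fn0 n : F n 0 = 1 by elim: n => // n <-.
elim=> [|n IHn] j; first by rewrite leqn0 => /eqP->; rewrite Fcap F00.
elim: j => [_|j IHj lt_jn].
  by rewrite FS // Fn0; have := IHn 0 isT; rewrite !bin0 !bin1; lia.
have {}IHj := IHj (ltnW lt_jn).
have e1 : n.+1 + j + 2 = n + j + 3 by lia.
have e2 : n.+1 + j.+1 + 2 = (n + j + 3).+1 by lia.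
rewrite e1 in IHj; rewrite e2 !binS.
move: lt_jn; rewrite ltnS leq_eqVlt => /orP[/eqP ej|lt_jn].
  subst n; rewrite Fcap.
  have <- : 'C(j + j + 3, j.+1) = 'C(j + j + 3, j.+2).
    by rewrite -bin_sub; [congr 'C(_, _)|]; lia.
  by lia.
have := IHn j.+1 lt_jn.
have -> : n + j.+1 + 2 = n + j + 3 by lia.
by rewrite FS //; lia.
Qed.

Definition num132 n j := #|[set s : 'S_n.+1 | avoids mesh132 s & s ord0 <= j]|.

Lemma card_avoids_132_first n (j : 'I_n.+2) :
  #|[set s : 'S_n.+2 | avoids mesh132 s & s ord0 == j]| = num132 n j.
Proof.
rewrite (card_lift_perm _ _ (fun s => avoids mesh132 s)).
by apply: eq_card => s; rewrite !inE avoids_132_lift0.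
Qed.

Lemma num132_0 n : num132 n.+1 0 = num132 n 0.
Proof.
rewrite -(card_avoids_132_first (@ord0 n.+1)).
by apply: eq_card => s; rewrite !inE leqn0.
Qed.

(** The permutations with first letter exactly [j.+1] are, after deletion of that
    letter, the 132-avoiders with first letter at most [j.+1]. *)
Lemma num132_S n j : j <= n -> num132 n.+1 j.+1 = num132 n.+1 j + num132 n j.+1.
Proof.
move=> le_jn; have lt_j : j.+1 < n.+2 by lia.
rewrite -(card_avoids_132_first (Ordinal lt_j)) /num132.
rewrite -(cardsID [set s : 'S_n.+2 | s ord0 <= j]).
congr (_ + _); apply: eq_card => s; rewrite !inE -?val_eqE /=;
  case: (avoids _ _) => //=; lia.
Qed.

Lemma num132_full n j : n <= j -> num132 n j = #|[set s : 'S_n.+1 | avoids mesh132 s]|.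
Proof.
move=> le_nj; apply: eq_card => s; rewrite !inE.
by have := ltn_ord (s ord0); case: (avoids _ _) => //=; lia.
Qed.

Lemma num132_00 : num132 0 0 = 1.
Proof.
rewrite num132_full // -[RHS]/(1`!) -card_Sn cardsE; apply: eq_card => s.
rewrite !inE; apply/avoids_132P => i j.
by rewrite (ord1 i) (ord1 j).
Qed.

Lemma card_avoids_132 n : #|[set s : 'S_n | avoids mesh132 s]| = catalan n.
Proof.
case: n => [|n].
  rewrite /catalan -[RHS]/(0`!) -card_Sn cardsE; apply: eq_card => s.
  by rewrite !inE; apply/avoids_132P => -[].
rewrite -(@num132_full n n.+1) //.
have := ballot_binomial num132_00 num132_0 num132_S
  (fun n => etrans (num132_full (leqnSn n)) (esym (num132_full (leqnn n)))) (leqnn n).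
have -> : n + n + 2 = 2 * n.+1 by lia.
have := mul_bin_left (2 * n.+1) n.
have -> : 2 * n.+1 - n = n.+2 by lia.
move=> A B.
suff: num132 n n.+1 * n.+2 = 'C(2 * n.+1, n.+1).
  by rewrite /catalan => <-; rewrite mulnK.
by rewrite -B in A *; nia.
Qed.

(** * Permutations whose maximum is not last *)

(** Each value is the number of smaller values, hence readable from the order
    pattern. *)
Lemma perm_order_inj n (s t : 'S_n) :
  (forall i j : 'I_n, i < j -> (s i < s j) = (t i < t j)) -> s = t.
Proof.
move=> H.
have {}H i j : (s i < s j) = (t i < t j).
  case: (ltngtP i j) => [/H//|ji|/val_inj->]; last by rewrite !ltnn.
  have := H j i ji.
  have : s i != s j by rewrite (inj_eq perm_inj) -val_eqE /=; lia.
  have : t i != t j by rewrite (inj_eq perm_inj) -val_eqE /=; lia.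
  by rewrite -!val_eqE /=; lia.
have rank (u : 'S_n) i : u i = #|[set j | u j < u i]| :> nat.
  transitivity (\sum_(k < u i) 1); first by rewrite sum1_card card_ord.
  rewrite (big_ord_widen n (fun=> 1) (ltnW (ltn_ord (u i)))).
  rewrite -(card_imset _ (@perm_inj _ u)) -sum1_card.
  apply: eq_bigl => k; apply/idP/imsetP => [ki|[j]]; last by rewrite inE => ji ->.
  by exists (u^-1 k)%g; rewrite ?inE permKV.
by apply/permP => i; apply: val_inj; rewrite /= rank [RHS]rank; apply: eq_card => j; rewrite !inE H.
Qed.

(** Translation modulo [m.+1] by the amount that puts the maximum at position
    [p]; the case split replaces modular arithmetic, so that linear arithmetic
    settles all comparisons. *)
Definition shift_fun m (p i : 'I_m.+1) : 'I_m.+1 :=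
  inord (if i <= p then i + (m - p) else i - p.+1).

Lemma shift_funE m (p i : 'I_m.+1) :
  shift_fun p i = (if i <= p then i + (m - p) else i - p.+1) :> nat.
Proof.
by rewrite inordK //; have := ltn_ord i; have := ltn_ord p; case: ifP; lia.
Qed.

Lemma shift_fun_inj m (p : 'I_m.+1) : injective (shift_fun p).
Proof.
move=> i j /(congr1 val) /=; rewrite !shift_funE => e; apply: val_inj => /=.
by have := ltn_ord i; have := ltn_ord j; have := ltn_ord p;
  move: e; case: ifP; case: ifP; lia.
Qed.

Definition shift_perm m (p : 'I_m.+1) : 'S_m.+1 := perm (@shift_fun_inj m p).

(** The inversions are exactly the pairs straddling [p], which by
    [perm_order_inj] characterizes the shift. *)
Lemma shift_perm_ltE m (p i j : 'I_m.+1) : i < j ->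
  (shift_perm p i < shift_perm p j) = ~~ (i <= p < j).
Proof.
rewrite !permE !shift_funE; have := ltn_ord i; have := ltn_ord j; have := ltn_ord p.
by case: ifP; case: ifP; lia.
Qed.

Lemma shift_perm_max m (p : 'I_m.+1) : shift_perm p p = ord_max.
Proof. by apply: val_inj; rewrite /= permE shift_funE leqnn /=; have := ltn_ord p; lia. Qed.

Lemma shift_perm_inj m : injective (@shift_perm m).
Proof.
by move=> p q e; apply: (@perm_inj _ (shift_perm p)); rewrite {2}e !shift_perm_max.
Qed.

Lemma shift_perm_avoids m (p : 'I_m.+1) :
  avoids mesh132 (shift_perm p) && avoids D3 (shift_perm p).
Proof.
have Av : avoids mesh132 (shift_perm p).
  apply/avoids_132P => i j k ij jk; rewrite shift_perm_ltE; last lia.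
  move=> A; rewrite ltnNge leq_eqVlt shift_perm_ltE //.
  by apply/negP/negPn; lia.
rewrite Av; apply/(avoids_D3P Av) => i j k ij jk.
rewrite ltnNge leq_eqVlt shift_perm_ltE // => A.
rewrite ltnNge leq_eqVlt shift_perm_ltE // => B.
by lia.
Qed.

(** With [p] the position of the maximum, avoiding 132 forces an inversion
    between any letter before [p] and any letter after it.  An inversion on one
    side of [p] would extend to a 321 with no larger value to its right: by the
    last letter if both are before [p], by the maximum if both are after. *)
Lemma avoids_132_D3_shift m (s : 'S_m.+1) : avoids mesh132 s -> avoids D3 s ->
  s ord_max != ord_max -> exists2 p : 'I_m.+1, p != ord_max & s = shift_perm p.
Proof.
move=> Av /(avoids_D3P Av) H; move/avoids_132P: Av => Av neq.
pose p := (s^-1)%g ord_max.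
have sp : s p = ord_max by rewrite permKV.
have p_neq : p != ord_max by apply: contraNneq neq => e; rewrite -{1}e sp.
exists p => //.
have ltp k : p != k -> s k < s p.
  have := ltn_ord (s k).
  by rewrite -(inj_eq (@perm_inj _ s)) sp -val_eqE /=; lia.
have neqs (i j : 'I_m.+1) : i < j -> s i <> s j :> nat.
  by move=> ij /val_inj/perm_inj e; rewrite e ltnn in ij.
have lt_p : p < @ord_max m.
  by move: p_neq; rewrite -val_eqE /=; have := ltn_ord p; lia.
have across (i k : 'I_m.+1) : i < p -> p < k -> s k < s i.
  move=> ip pk; rewrite ltnNge leq_eqVlt; apply/negP => /orP[/eqP|A].
    by apply: neqs; lia.
  by apply: (Av i p k) => //; apply: ltp; rewrite -val_eqE /=; lia.
apply: perm_order_inj => i j ij; rewrite shift_perm_ltE //.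
have [ip|pi] := leqP i p; have [pj|jp] := ltnP p j => /=.
- apply/negbTE; rewrite -leqNgt.
  move: ip; rewrite leq_eqVlt => /orP[/eqP/val_inj ->|ip]; last exact/ltnW/across.
  by apply/ltnW/ltp; rewrite -val_eqE /=; lia.
- move: jp; rewrite leq_eqVlt => /orP[/eqP/val_inj ej|jp].
    by rewrite ej; apply: ltp; rewrite -val_eqE /= -ej; lia.
  rewrite ltnNge leq_eqVlt; apply/negP => /orP[/eqP e|ji]; first by case: (neqs i j ij).
  have [r] := H i j ord_max ij (ltn_trans jp lt_p) ji (across j _ jp lt_p).
  by have := ltn_ord r => /=; lia.
- rewrite ltnNge leq_eqVlt; apply/negP => /orP[/eqP e|ji]; first by case: (neqs i j ij).
  have [|r _] := H p i j pi ij _ ji; first by apply: ltp; rewrite -val_eqE /=; lia.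
  by rewrite sp; have := ltn_ord (s r) => /=; lia.
- lia.
Qed.

(** * Permutations whose maximum is last, and the total *)

Lemma avoids_D3_fix_max m (s : 'S_m.+1) : avoids mesh132 s ->
  s ord_max = ord_max -> avoids D3 s.
Proof.
move=> Av fix_max; apply/(avoids_D3P Av) => i j k ij jk ji kj.
have lt_max (x : 'I_m.+1) : x != ord_max -> x < @ord_max m.
  by rewrite -val_eqE /=; have := ltn_ord x; lia.
exists ord_max; rewrite ?fix_max; apply: lt_max.
  by apply: contraTneq kj => ->; rewrite fix_max -leqNgt -ltnS.
rewrite -fix_max (inj_eq perm_inj).
by apply: contraTneq ij => ->; rewrite -leqNgt -ltnS.
Qed.

Theorem theorem4p5 (n : nat) (n_ge1 : 1 <= n) :
  #|avoiders2 n mesh132 D3| = catalan (n - 1) + n - 1.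
Proof.
case: n n_ge1 => // m _; rewrite subn1 /= addnS subn1 /=.
rewrite -(cardsID [set s : 'S_m.+1 | s ord_max == ord_max]); congr (_ + _).
  rewrite -card_avoids_132.
  transitivity #|[set s : 'S_m.+1 | avoids mesh132 s & s ord_max == ord_max]|.
    apply: eq_card => s; rewrite !inE; apply/andP/andP => [[/andP[-> _]] //|[Av fix_max]].
    by rewrite Av (avoids_D3_fix_max Av (eqP fix_max)).
  rewrite (card_lift_perm _ _ (fun s => avoids mesh132 s)).
  by apply: eq_card => s; rewrite !inE avoids_132_lift_max.
transitivity #|[set shift_perm p | p in [set~ @ord_max m]]|.
  apply: eq_card => s; rewrite !inE; apply/andP/imsetP => [[neq /andP[Av AvD]]|[p]].
    by have [p pm ->] := avoids_132_D3_shift Av AvD neq; exists p; rewrite // !inE.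
  rewrite !inE => pm ->; rewrite shift_perm_avoids; split=> //.
  by rewrite -{2}(shift_perm_max p) (inj_eq perm_inj) eq_sym.
by rewrite (card_imset _ (@shift_perm_inj m)) cardsC1 card_ord.
Qed.
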